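(* Let $\boldsymbol{\tilde A},\boldsymbol{\tilde B}\in\mathcal{X}^{m\times n}$ and $\boldsymbol{\tilde b},\boldsymbol{\tilde b}'\in\mathcal{X}^m$. Elementary row operations do not change the solution set of a fully-fuzzy linear system; more precisely, if the augmented fuzzy matrices $(\boldsymbol{\tilde A}\;\boldsymbol{\tilde b})$ and $(\boldsymbol{\tilde B}\;\boldsymbol{\tilde b}')$ are row equivalent, then $\boldsymbol{\tilde A}\boldsymbol{\tilde x}=\boldsymbol{\tilde b}$ and $\boldsymbol{\tilde B}\boldsymbol{\tilde x}=\boldsymbol{\tilde b}'$ have the same solution set in $\mathcal{X}^n$.
   Context: Gaussian-PDMF space $\mathcal{X}$: the set of functions $f:\mathbb{R}\to[0,1]$ with parameters $x\in\mathbb{R}$, $d^-,d^+>0$, $\mu^-,\mu^+\in\mathbb{R}$, given by $f(x)=1$, $f(\tau)=0$ for $\tau\le x-d^-$ or $\tau\ge x+d^+$, $f(\tau)=\int_{-\infty}^{\tan(\frac{\pi}{d^-}(\tau-x+d^-)-\frac{\pi}{2})}\frac{1}{\sqrt{2\pi}}e^{-\frac12(t-\mu^-)^2}dt$ for $\tau\in(x-d^-,x)$, and $f(\tau)=\int_{-\infty}^{\tan(\frac{\pi}{d^+}(x+d^+-\tau)-\frac{\pi}{2})}\frac{1}{\sqrt{2\pi}}e^{-\frac12(t-\mu^+)^2}dt$ for $\tau\in(x,x+d^+)$. Such an element is identified with its parameter tuple, written $\tilde x=\langle x;d^-,d^+,\mu^-,\mu^+\rangle$; two elements are equal iff all five parameters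 coincide. Operations on $\mathcal{X}$, for $\tilde x_i=\langle x_i;d_i^-,d_i^+,\mu_i^-,\mu_i^+\rangle$: $\tilde x_1+\tilde x_2=\langle x_1+x_2;d_1^-d_2^-,d_1^+d_2^+,\mu_1^-+\mu_2^-,\mu_1^++\mu_2^+\rangle$; $\tilde x_1\tilde x_2=\langle x_1x_2;(d_1^-)^{\ln d_2^-},(d_1^+)^{\ln d_2^+},\mu_1^-\mu_2^-,\mu_1^+\mu_2^+\rangle$. With these operations $\mathcal{X}$ is a commutative ring with zero $\tilde 0=\langle0;1,1,0,0\rangle$ and identity $\tilde1=\langle1;e,e,1,1\rangle$ ($e$ is Euler's number). Its set of units is $U(\mathcal{X})=\{\langle x;d^-,d^+,\mu^-,\mu^+\rangle\in\mathcal{X}: x\ne0,\ d^-\ne1,\ d^+\ne1,\ \mu^-\ne0,\ \mu^+\ne0\}$. For $\boldsymbol{\tilde A}=(\tilde a_{ij})\in\mathcal{X}^{m\times n}$ and $\boldsymbol{\tilde x}\in\mathcal{X}^n$, $\boldsymbol{\tilde A}\boldsymbol{\tilde x}\in\mathcal{X}^m$ has $i$-th entry $\sum_{k=1}^n\tilde a_{ik}\tilde x_k$. An elementary row operation on a fuzzy matrix over $\mathcal{X}$ is one of: (i) interchanging two rows; (ii) left-multiplying a row by a unit $\tilde c\in U(\mathcal{X})$; (iii) for $\tilde r\in\mathcal{X}$ and $i\ne j$, adding $\tilde r$ times row $j$ to row $i$. Two fuzzy matrices are row equivalent if one can be transformed into the other by a finite sequence of elementary row operations. *)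

(* Defs.v *)
From HB Require Import structures.
From Stdlib Require Import Relation_Operators.
From mathcomp Require Import all_boot all_order all_algebra.
From mathcomp Require Import all_classical all_reals all_analysis.
From mathcomp Require Import ring lra.

Set Implicit Arguments.
Unset Strict Implicit.
Unset Printing Implicit Defensive.

Import Order.TTheory GRing.Theory Num.Theory.
Import numFieldNormedType.Exports.

Local Open Scope classical_set_scope.
Local Open Scope ring_scope.

Section GaussianIntegral.
Variable R : realType.
Implicit Types mu u t : R.
Local Notation leb := (@lebesgue_measure R).

Definition gauss_density mu t : R :=
  (Num.sqrt (2 * pi))^-1 * expR (- (2^-1 * (t - mu) ^+ 2)).

Definition gauss_cdf mu u : R :=
  (\int[leb]_(t in `]-oo, u]) gauss_density mu t)%R.

Lemma gauss_densityE mu : gauss_density mu = normal_pdf mu 1.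
Proof.
apply/funext => t; rewrite normal_pdfE ?oner_neq0// /gauss_density.
rewrite /normal_peak /normal_fun expr1n mul1r mulr_natl.
by congr (_ * expR _); rewrite mulNr mulrC.
Qed.

Lemma gauss_density_gt0 mu t : 0 < gauss_density mu t.
Proof.
by rewrite mulr_gt0 ?expR_gt0// invr_gt0 sqrtr_gt0 mulr_gt0 ?pi_gt0.
Qed.

Lemma integrable_gauss_density mu (D : set R) : measurable D ->
  leb.-integrable D (EFin \o gauss_density mu).
Proof.
move=> mD; rewrite gauss_densityE.
apply: (@integrableS _ _ _ _ setT) => //.
exact: integrable_normal_pdf.
Qed.

Lemma Rintegral_gt0 (D : set R) (f : R -> R) : measurable D ->
  leb D != 0%E -> leb.-integrable D (EFin \o f) ->
  (forall t, D t -> 0 < f t) -> 0 < (\int[leb]_(t in D) f t)%R.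
Proof.
move=> mD D0 fi f0; rewrite lt_neqAle Rintegral_ge0 ?andbT; last first.
  by move=> t /f0/ltW.
apply/eqP => /esym If0.
have mf := measurable_int _ fi.
have : (\int[leb]_(t in D) `|(EFin \o f) t|)%E = 0%R.
  have -> : (\int[leb]_(t in D) `|(EFin \o f) t|)%E
          = (\int[leb]_(t in D) (EFin \o f) t)%E.
    by apply: eq_integral => t /set_mem/f0/ltW ft /=; rewrite ger0_norm.
  by rewrite -[LHS]fineK ?integrable_fin_num//; congr EFin.
move/(proj1 (ae_eq_integral_abs leb mD mf)) => [N [mN N0 DN]].
move/eqP: D0; apply; apply/eqP; rewrite eq_le measure_ge0 andbT -N0.
apply: le_measure; rewrite ?inE// => t Dt; apply: DN => /= /(_ Dt) [ft].
by have := f0 _ Dt; rewrite ft ltxx.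
Qed.

Lemma gauss_cdf_gt0 mu u : 0 < gauss_cdf mu u.
Proof.
apply: Rintegral_gt0 => //.
- by rewrite lebesgue_measure_itv /= ltNyr.
- exact: integrable_gauss_density.
- by move=> t _; exact: gauss_density_gt0.
Qed.

Lemma gauss_cdf_lt1 mu u : gauss_cdf mu u < 1.
Proof.
have : (\int[leb]_t gauss_density mu t)%R = 1.
  by rewrite gauss_densityE /Rintegral integral_normal_pdf.
have -> : [set: R] = `]-oo, u] `|` `]u, +oo[.
  by rewrite -set_itvNyy (@itv_bndbnd_setU _ _ _ (BRight u))// bnd_simp.
rewrite Rintegral_setU//; last 2 first.
- by apply: integrable_gauss_density; apply: measurableU.
- apply/disj_setPS => t /= []; rewrite !in_itv/= andbT => tu ut.
  by have := le_lt_trans tu ut; rewrite ltxx.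
move=> <-; rewrite -[ltLHS]addr0 ltrD2l.
apply: Rintegral_gt0 => //.
- by rewrite lebesgue_measure_itv /= ltry.
- exact: integrable_gauss_density.
- by move=> t _; exact: gauss_density_gt0.
Qed.

Lemma gauss_cdf_inj mu1 mu2 : gauss_cdf mu1 =1 gauss_cdf mu2 -> mu1 = mu2.
Proof.
wlog : mu1 mu2 / mu1 <= mu2.
  move=> W e; case/orP: (le_total mu1 mu2) => h; first exact: W.
  by apply/esym/W => // t; rewrite e.
rewrite le_eqVlt => /orP[/eqP//|lt12] e; exfalso.
pose c := (mu1 + mu2) / 2; pose a : R := c - 1.
have ac : a < c by rewrite ltrBlDr ltrDl.
have : 0 < (\int[leb]_(t in `]-oo, a])
    (gauss_density mu1 t - gauss_density mu2 t))%R.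
  apply: Rintegral_gt0 => //.
  - by rewrite lebesgue_measure_itv /= ltNyr.
  - have mi : measurable (`]-oo, a] : set R) by [].
    exact: (@integrableB _ _ _ leb _ mi _ _ (integrable_gauss_density mu1 mi)
                                           (integrable_gauss_density mu2 mi)).
  - move=> t /=; rewrite in_itv/= => ta.
    rewrite subr_gt0 ltr_pM2l ?invr_gt0 ?sqrtr_gt0 ?mulr_gt0 ?pi_gt0//.
    rewrite ltr_expR ltrN2 ltr_pM2l ?invr_gt0// -subr_gt0.
    have -> : (t - mu2) ^+ 2 - (t - mu1) ^+ 2 = (mu2 - mu1) * (2 * (c - t)).
      by rewrite /c; field.
    by rewrite !mulr_gt0// subr_gt0// (le_lt_trans ta).
rewrite RintegralB//; try exact: integrable_gauss_density.
by have := e a; rewrite /gauss_cdf => ->; rewrite subrr ltxx.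
Qed.

End GaussianIntegral.

Section Space.
Variable R : realType.

Definition membership (x dm dp mum mup tau : R) : R :=
  if tau == x then 1
  else if (tau <= x - dm) || (x + dp <= tau) then 0
  else if tau < x then
    gauss_cdf mum (tan (pi / dm * (tau - x + dm) - pi / 2))
  else gauss_cdf mup (tan (pi / dp * (x + dp - tau) - pi / 2)).

(* Parameter tuple < x ; d^-, d^+, mu^-, mu^+ >; its membership function is
   gpdmf_fun below. *)
Record gpdmf := GPDMF {
  core : R;
  dm : R;
  dp : R;
  mum : R;
  mup : R;
  dm_gt0 : 0 < dm;
  dp_gt0 : 0 < dp }.

Definition gpdmf_fun (f : gpdmf) : R -> R :=
  membership (core f) (dm f) (dp f) (mum f) (mup f).

Lemma gpdmfP (f g : gpdmf) : core f = core g -> dm f = dm g -> dp f = dp g ->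
  mum f = mum g -> mup f = mup g -> f = g.
Proof.
case: f g => x a b c d a0 b0 [x' a' b' c' d' a0' b0'] /= *; subst.
by congr GPDMF; exact: bool_irrelevance.
Qed.

Lemma gpdmf_fun_itv f tau : 0 <= gpdmf_fun f tau <= 1.
Proof.
rewrite /gpdmf_fun /membership; do 3! [case: ifP => _; first by
  rewrite ?lexx ?ler01 // !ltW ?gauss_cdf_gt0 ?gauss_cdf_lt1].
by rewrite !ltW ?gauss_cdf_gt0 ?gauss_cdf_lt1.
Qed.

Let fun1 f tau : (gpdmf_fun f tau == 1) = (tau == core f).
Proof.
rewrite /gpdmf_fun /membership; case: ifP => [_|_]; first by rewrite eqxx.
case: ifP => [_|_]; first by rewrite eq_sym oner_eq0.
by case: ifP => _; rewrite lt_eqF// gauss_cdf_lt1.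
Qed.

Let fun0 f tau :
  (gpdmf_fun f tau == 0) = (tau <= core f - dm f) || (core f + dp f <= tau).
Proof.
rewrite /gpdmf_fun /membership; case: ifP => [/eqP->|_].
  rewrite oner_eq0 lerBrDr gerDl leNgt dm_gt0/=.
  by rewrite gerDl leNgt dp_gt0.
case: ifP => [_|_]; first by rewrite eqxx.
by case: ifP => _; rewrite gt_eqF// gauss_cdf_gt0.
Qed.

Let funm f u : exists2 tau, gpdmf_fun f tau = gauss_cdf (mum f) u
  & tau = core f - dm f + dm f / pi * (atan u + pi / 2).
Proof.
have pi0 : (0 : R) < pi by exact: pi_gt0.
have d0 := dm_gt0 f; set tau := core f - _ + _; exists tau => //.
have s0 : 0 < atan u + pi / 2 by have := atan_gtNpi2 u; lra.
have s1 : atan u + pi / 2 < pi by have := atan_ltpi2 u; lra.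
have d1 : dm f / pi * (atan u + pi / 2) < dm f.
  by rewrite mulrAC ltr_pdivrMr// ltr_pM2l.
have d2 : 0 < dm f / pi * (atan u + pi / 2) by rewrite mulr_gt0 ?divr_gt0.
have t1 : core f - dm f < tau by rewrite ltrDl.
have t2 : tau < core f by rewrite /tau; lra.
rewrite /gpdmf_fun /membership lt_eqF// leNgt t1/= leNgt.
rewrite (lt_trans t2) ?ltrDl ?dp_gt0//= t2.
congr gauss_cdf; rewrite -[RHS]atanK; congr tan; rewrite /tau.
by move: (pi : R) pi0 => q q0; field; rewrite !gt_eqF.
Qed.

Let funp f u : exists2 tau, gpdmf_fun f tau = gauss_cdf (mup f) u
  & tau = core f + dp f - dp f / pi * (atan u + pi / 2).
Proof.
have pi0 : (0 : R) < pi by exact: pi_gt0.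
have d0 := dp_gt0 f; set tau := core f + _ - _; exists tau => //.
have s0 : 0 < atan u + pi / 2 by have := atan_gtNpi2 u; lra.
have s1 : atan u + pi / 2 < pi by have := atan_ltpi2 u; lra.
have d1 : dp f / pi * (atan u + pi / 2) < dp f.
  by rewrite mulrAC ltr_pdivrMr// ltr_pM2l.
have d2 : 0 < dp f / pi * (atan u + pi / 2) by rewrite mulr_gt0 ?divr_gt0.
have t1 : tau < core f + dp f by rewrite gtrDl oppr_lt0.
have t2 : core f < tau by rewrite /tau; lra.
rewrite /gpdmf_fun /membership gt_eqF// [core f + dp f <= _]leNgt t1/= orbF.
rewrite leNgt (lt_trans _ t2) ?gtrDl ?oppr_lt0 ?dm_gt0//= ltNge (ltW t2)/=.
congr gauss_cdf; rewrite -[RHS]atanK; congr tan; rewrite /tau.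
by move: (pi : R) pi0 => q q0; field; rewrite !gt_eqF.
Qed.

(* Hence parameter tuples and membership functions can be identified. *)
Lemma gpdmf_fun_inj : injective gpdmf_fun.
Proof.
move=> f g fg.
have ex : core f = core g by apply/eqP; rewrite -fun1 -fg fun1.
have em : dm f = dm g.
  have H h t : (gpdmf_fun h t == 0) && (t < core h) = (t <= core h - dm h).
    rewrite fun0; case: (ltP t (core h)) => th; rewrite ?andbT ?andbF.
      by rewrite [X in _ || X]leNgt (lt_trans th) ?ltrDl ?dp_gt0 ?orbF.
    by apply/esym/negbTE; rewrite -ltNge (lt_le_trans _ th)// gtrDl oppr_lt0 dm_gt0.
  have K t : (t <= core g - dm f) = (t <= core g - dm g).
    by rewrite -{1}ex -!H fg ex.
  apply/oppr_inj/(@addrI _ (core g))/le_anti.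
  by rewrite -K lexx K lexx.
have ep : dp f = dp g.
  have H h t : (gpdmf_fun h t == 0) && (core h < t) = (core h + dp h <= t).
    rewrite fun0; case: (ltP (core h) t) => th; rewrite ?andbT ?andbF.
      by rewrite leNgt (lt_trans _ th) ?gtrDl ?oppr_lt0 ?dm_gt0.
    by apply/esym/negbTE; rewrite -ltNge (le_lt_trans th)// ltrDl dp_gt0.
  have K t : (core g + dp f <= t) = (core g + dp g <= t).
    by rewrite -{1}ex -!H fg ex.
  apply/(@addrI _ (core g))/le_anti.
  by rewrite K lexx -K lexx.
apply: gpdmfP => //; apply: gauss_cdf_inj => u.
- have [t <- ->] := funm f u; have [t' <- ->] := funm g u.
  by rewrite fg ex em.
- have [t <- ->] := funp f u; have [t' <- ->] := funp g u.
  by rewrite fg ex ep.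
Qed.

HB.instance Definition _ := gen_eqMixin gpdmf.
HB.instance Definition _ := gen_choiceMixin gpdmf.

Definition gpdmf_zero : gpdmf := @GPDMF 0 1 1 0 0 ltr01 ltr01.

Definition gpdmf_one : gpdmf :=
  @GPDMF 1 (expR 1) (expR 1) 1 1 (expR_gt0 1) (expR_gt0 1).

Definition gpdmf_add f g : gpdmf :=
  @GPDMF (core f + core g) (dm f * dm g) (dp f * dp g)
    (mum f + mum g) (mup f + mup g)
    (mulr_gt0 (dm_gt0 f) (dm_gt0 g)) (mulr_gt0 (dp_gt0 f) (dp_gt0 g)).

Definition gpdmf_mul f g : gpdmf :=
  @GPDMF (core f * core g) (dm f `^ ln (dm g)) (dp f `^ ln (dp g))
    (mum f * mum g) (mup f * mup g)
    (powR_gt0 (ln (dm g)) (dm_gt0 f)) (powR_gt0 (ln (dp g)) (dp_gt0 f)).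

Let invr_pos (d : R) : 0 < d -> 0 < d^-1. Proof. by rewrite invr_gt0. Qed.

Definition gpdmf_opp f : gpdmf :=
  @GPDMF (- core f) (dm f)^-1 (dp f)^-1 (- mum f) (- mup f)
    (invr_pos (dm_gt0 f)) (invr_pos (dp_gt0 f)).

Definition gpdmf_unit : {pred gpdmf} := fun f =>
  [&& core f != 0, dm f != 1, dp f != 1, mum f != 0 & mup f != 0].

Definition gpdmf_inv f : gpdmf :=
  if gpdmf_unit f then
    @GPDMF (core f)^-1 (expR (ln (dm f))^-1) (expR (ln (dp f))^-1)
      (mum f)^-1 (mup f)^-1
      (expR_gt0 (ln (dm f))^-1) (expR_gt0 (ln (dp f))^-1)
  else f.

(* f |-> (core, ln dm, ln dp, mum, mup) turns the operations into the
   componentwise ones of R ^ 5. *)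
Let lnP f g : core f = core g -> ln (dm f) = ln (dm g) ->
  ln (dp f) = ln (dp g) -> mum f = mum g -> mup f = mup g -> f = g.
Proof.
move=> ex em ep; apply: gpdmfP => //; apply: ln_inj => //; rewrite posrE.
- exact: dm_gt0.
- exact: dm_gt0.
- exact: dp_gt0.
- exact: dp_gt0.
Qed.

Let lnMp (a b : R) : 0 < a -> 0 < b -> ln (a * b) = ln a + ln b.
Proof. by move=> a0 b0; rewrite lnM. Qed.

Let lnVp (a : R) : 0 < a -> ln a^-1 = - ln a.
Proof. by move=> a0; rewrite lnV. Qed.

Let simps := (lnMp, lnVp, @ln_powR R, @ln1 R, @expRK R,
  dm_gt0, dp_gt0, mulr_gt0, powR_gt0, invr_gt0).

Let addA : associative gpdmf_add.
Proof. by move=> f g h; apply: lnP; rewrite /= ?simps// addrA. Qed.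

Let addC : commutative gpdmf_add.
Proof. by move=> f g; apply: lnP; rewrite /= ?simps// addrC. Qed.

Let add0 : left_id gpdmf_zero gpdmf_add.
Proof. by move=> f; apply: lnP; rewrite /= ?mul1r// add0r. Qed.

Let addN : left_inverse gpdmf_zero gpdmf_opp gpdmf_add.
Proof. by move=> f; apply: lnP; rewrite /= ?simps// addNr. Qed.

HB.instance Definition _ := GRing.isZmodule.Build gpdmf addA addC add0 addN.

Let mulA : associative gpdmf_mul.
Proof.
by move=> f g h; apply: lnP; rewrite /= ?simps; rewrite ?mulrA//;
  rewrite -?mulrA // mulrC -?mulrA// mulrC.
Qed.

Let mulC : commutative gpdmf_mul.
Proof. by move=> f g; apply: lnP; rewrite /= ?simps// mulrC. Qed.

Let mul1 : left_id gpdmf_one gpdmf_mul.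
Proof. by move=> f; apply: lnP; rewrite /= ?simps ?mulr1 ?mul1r. Qed.

Let mulD : left_distributive gpdmf_mul gpdmf_add.
Proof.
by move=> f g h; apply: lnP; rewrite /= ?simps ?mulrDl ?mulrDr.
Qed.

Let one_neq0 : gpdmf_one != gpdmf_zero.
Proof. by apply/eqP => /(congr1 core)/eqP; rewrite /= oner_eq0. Qed.

HB.instance Definition _ :=
  GRing.Zmodule_isComNzRing.Build gpdmf mulA mulC mul1 mulD one_neq0.

Let ln_neq0 (d : R) : 0 < d -> (ln d == 0) = (d == 1).
Proof.
move=> d0; apply/eqP/eqP => [|->]; last exact: ln1.
by rewrite -ln1; apply: ln_inj; rewrite posrE.
Qed.

Let mulV : {in gpdmf_unit, left_inverse 1 gpdmf_inv *%R}.
Proof.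
move=> f fu; have fu' : gpdmf_unit f := fu; rewrite /gpdmf_inv fu'.
case/and5P: fu' => x0 a0 b0 c0 d0.
by apply: lnP; rewrite /= ?simps ?mulVf ?mulfV ?ln_neq0 ?dm_gt0 ?dp_gt0.
Qed.

Let unitPl (f g : gpdmf) : g * f = 1 -> gpdmf_unit f.
Proof.
move=> gf; have nz (a b : R) : a * b = 1 -> b != 0.
  by move=> ab; apply/eqP => b0; move/eqP: ab; rewrite b0 mulr0 eq_sym oner_eq0.
have ln' (d d' : R) : 0 < d' -> d `^ ln d' = expR 1 -> d' != 1.
  move=> d0 /(congr1 (@ln R)); rewrite ln_powR expRK mulrC => /nz.
  by rewrite ln_neq0.
apply/and5P; split.
- exact: (nz (core g)) (congr1 core gf).
- by apply: (ln' (dm g)) (dm_gt0 f) (congr1 dm gf).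
- by apply: (ln' (dp g)) (dp_gt0 f) (congr1 dp gf).
- exact: (nz (mum g)) (congr1 mum gf).
- exact: (nz (mup g)) (congr1 mup gf).
Qed.

Let inv_out : {in [predC gpdmf_unit], gpdmf_inv =1 id}.
Proof.
move=> f fu; have /negbTE fu' : ~~ gpdmf_unit f := fu.
by rewrite /gpdmf_inv fu'.
Qed.

HB.instance Definition _ :=
  GRing.ComNzRing_hasMulInverse.Build gpdmf mulV unitPl inv_out.

End Space.

Section RowEquivalence.
Variables (S : comUnitRingType) (m p : nat).
Implicit Types A B : 'M[S]_(m, p).

Definition scale_row (i : 'I_m) (c : S) A : 'M[S]_(m, p) :=
  \matrix_(k, l) if k == i then c * A k l else A k l.

Definition add_row (i j : 'I_m) (r : S) A : 'M[S]_(m, p) :=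
  \matrix_(k, l) if k == i then A k l + r * A j l else A k l.

Inductive elementary_row_op A : 'M[S]_(m, p) -> Prop :=
| RowSwap i j : i != j -> elementary_row_op A (xrow i j A)
| RowScale i c : c \is a GRing.unit -> elementary_row_op A (scale_row i c A)
| RowAdd i j r : i != j -> elementary_row_op A (add_row i j r A).

Definition row_equivalent : 'M[S]_(m, p) -> 'M[S]_(m, p) -> Prop :=
  clos_refl_trans _ elementary_row_op.

End RowEquivalence.

(* Main.v *)
Require Import Defs.
From mathcomp Require Import all_boot all_order all_algebra.
From mathcomp Require Import perm.
From mathcomp Require Import all_classical all_reals all_analysis.

Import GRing.Theory.

Local Open Scope classical_set_scope.
Local Open Scope ring_scope.

(** A vector [x] solves [A x = b] exactly when the augmented matrix
    [(A b)] kills the column obtained by stacking [x] on top of [-1]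
    ([row_mx_solution]).  An elementary row operation on a matrix [M] induces
    the same operation on [M *m v] ([elementary_row_op_mulmx]), and, being
    reversible, its result is zero exactly when the matrix it is applied to is
    ([elementary_row_op_eq0]).  So row equivalent matrices kill the same
    columns.  The argument holds over any commutative ring with decidable
    units; the only fact about Gaussian PDMFs that it uses is that they form
    such a ring. *)

Section RowOperations.
Variables (S : comUnitRingType) (m p : nat).
Implicit Types A B : 'M[S]_(m, p).

Lemma scale_row_mulmx q i c A (v : 'M[S]_(p, q)) :
  scale_row i c A *m v = scale_row i c (A *m v).
Proof.
apply/matrixP => k l; rewrite !mxE; case: eqP => ki; last first.
  by apply: eq_bigr => t _; rewrite mxE (introF eqP ki).
by rewrite mulr_sumr; apply: eq_bigr => t _; rewrite mxE ki eqxx mulrA.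
Qed.

Lemma add_row_mulmx q i j r A (v : 'M[S]_(p, q)) :
  add_row i j r A *m v = add_row i j r (A *m v).
Proof.
apply/matrixP => k l; rewrite !mxE; case: eqP => ki; last first.
  by apply: eq_bigr => t _; rewrite mxE (introF eqP ki).
rewrite mulr_sumr -big_split; apply: eq_bigr => t _.
by rewrite mxE ki eqxx mulrDl mulrA.
Qed.

Lemma elementary_row_op_mulmx q A B (v : 'M[S]_(p, q)) :
  elementary_row_op A B -> elementary_row_op (A *m v) (B *m v).
Proof.
case=> [i j ij|i c uc|i j r ij].
- by rewrite xrowE -mulmxA -xrowE; exact: RowSwap.
- by rewrite scale_row_mulmx; exact: RowScale.
- by rewrite add_row_mulmx; exact: RowAdd.
Qed.

Lemma elementary_row_op_eq0 A B :
  elementary_row_op A B -> A = 0 <-> B = 0.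
Proof.
case=> [i j ij|i c uc|i j r ij]; split=> [->|/matrixP E];
  try (by apply/matrixP => k l; rewrite !mxE ?mulr0 ?addr0 ?if_same).
- apply/matrixP => k l.
  by have := E (tperm i j k) l; rewrite !mxE tpermK.
- apply/matrixP => k l; have := E k l; rewrite !mxE.
  by case: eqP => // _ /(congr1 ( *%R c^-1)); rewrite mulKr// mulr0.
- (* Row [j] is untouched since [i != j], so it vanishes already in [A]. *)
  have Aj l : A j l = 0 by have := E j l; rewrite !mxE eq_sym (negbTE ij).
  apply/matrixP => k l; have := E k l; rewrite !mxE Aj mulr0 addr0.
  by rewrite if_same.
Qed.

End RowOperations.

Lemma row_equivalent_mulmx_eq0 (S : comUnitRingType) (m p q : nat)
    (A B : 'M[S]_(m, p)) (v : 'M[S]_(p, q)) :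
  row_equivalent A B -> A *m v = 0 <-> B *m v = 0.
Proof.
elim=> [{}A {}B AB|//|A1 A2 A3 _ IH12 _ IH23].
  exact/elementary_row_op_eq0/elementary_row_op_mulmx.
exact: iff_trans IH12 IH23.
Qed.

Lemma row_mx_solution (S : nzRingType) (m n : nat)
    (A : 'M[S]_(m, n)) (b : 'cV[S]_m) (x : 'cV[S]_n) :
  A *m x = b <-> row_mx A b *m col_mx x (- 1%:M) = 0.
Proof.
rewrite mul_row_col mulmxN mulmx1.
by split=> [->|/eqP]; rewrite ?subrr// subr_eq0 => /eqP.
Qed.

Theorem proposition4p1 (R : realType) (m n : nat)
    (A B : 'M[gpdmf R]_(m, n)) (b b' : 'cV[gpdmf R]_m) :
  row_equivalent (row_mx A b) (row_mx B b') ->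
  [set x : 'cV[gpdmf R]_n | A *m x = b] =
  [set x : 'cV[gpdmf R]_n | B *m x = b'].
Proof.
move=> AB; apply/seteqP; split=> x /= /row_mx_solution Ax;
  by apply/row_mx_solution/(row_equivalent_mulmx_eq0 _ _ _ _ _ _ _ AB).
Qed.
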